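(* Let $n\ge 4$. Let $f=\frac1n\sum_{i=1}^n f_i:\mathbb{R}^d\to\mathbb{R}$ be $\mu$-strongly convex with $\mu>0$ and $L_f$-smooth, with minimizer $x^*$, and let each $f_i:\mathbb{R}^d\to\mathbb{R}$ be convex and $L$-smooth. Let $\mathcal{P}$ be the $\tau$-nice sampling with $\tau\in\{1,\dots,n\}$, and run Minibatch MISO with stepsize $\gamma=\frac{n}{\tau L_f+6L(n-\tau)/(n-1)}$. Let $\mathcal{A}=\frac{n(n-\tau)}{\tau(n-1)}$ and $\mathcal{W}^0=\sum_{i=1}^n\|\phi_i^0-x^*-\gamma f_i'(\phi_i^0)+\gamma f_i'(x^* )\|^2$. Then for every $\epsilon>0$ and every integer $k\ge 0$, $$k\ge 2\max\left\{\frac{n}{\tau},\ \frac{L_f}{\mu}+\frac{6L}{\tau\mu}\cdot\frac{n-\tau}{n-1}\right\}\log\left(\frac{\|x^0-x^*\|^2+\frac{4\mathcal{A}\tau}{n^3}\mathcal{W}^0}{\epsilon}\right)\quad\Longrightarrow\quad\mathbb{E}[\|x^k-x^*\|^2]\le\epsilon.$$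
   Context: A differentiable function is $L$-smooth if its gradient is Lipschitz with constant $L\ge 0$; $f'$ and $f_i'$ denote gradients. $\|\cdot\|$ is the Euclidean norm. If the argument of the logarithm is $0$, the logarithm is read as $-\infty$. $\tau$-nice sampling: the uniform distribution over the subsets of $\{1,\dots,n\}$ of cardinality $\tau$. Minibatch MISO with stepsize $\gamma>0$ and distribution $\mathcal{P}$ over subsets of $\{1,\dots,n\}$: given arbitrary deterministic $\phi_1^0,\dots,\phi_n^0\in\mathbb{R}^d$, set $x^0=\frac1n\sum_{i=1}^n\phi_i^0-\frac{\gamma}{n}\sum_{i=1}^n f_i'(\phi_i^0)$. For $k=0,1,\dots$: draw $S^k\sim\mathcal{P}$ independently of the past; set $\phi_i^{k+1}=x^k$ if $i\in S^k$ and $\phi_i^{k+1}=\phi_i^k$ if $i\notin S^k$; set $x^{k+1}=\frac1n\sum_{i=1}^n\phi_i^{k+1}-\frac{\gamma}{n}\sum_{i=1}^n f_i'(\phi_i^{k+1})$. *)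

(* Defs.v *)
From HB Require Import structures.
From mathcomp Require Import all_boot all_order all_algebra.
From mathcomp Require Import all_classical all_reals all_analysis.

Set Implicit Arguments.
Unset Strict Implicit.
Unset Printing Implicit Defensive.

Import Order.TTheory GRing.Theory Num.Theory.
Import numFieldNormedType.Exports.

Local Open Scope classical_set_scope.
Local Open Scope ring_scope.

(* The norm `|v| that the library puts on row vectors is the sup norm; it
   induces the same topology, hence the same notion of differentiability, as
   the Euclidean norm below. *)
Definition enorm (R : realType) (d : nat) (v : 'rV[R]_d) : R :=
  Num.sqrt (\sum_(j < d) v 0 j ^+ 2).

(* The vector representing the differential of [f] at [x]; it is the gradient
   only where [f] is differentiable. *)
Definition gradient (R : realType) (d : nat) (f : 'rV[R]_d -> R)
    (x : 'rV[R]_d) : 'rV[R]_d :=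
  \row_(j < d) 'd (f : 'rV[R]_d -> R^o) x (delta_mx 0 j).

Definition smooth_fun (R : realType) (d : nat) (L : R)
    (f : 'rV[R]_d -> R) : Prop :=
  [/\ 0 <= L,
      forall x, differentiable (f : 'rV[R]_d -> R^o) x
    & forall x y, enorm (gradient f x - gradient f y) <= L * enorm (x - y)].

Definition strongly_convex (R : realType) (d : nat) (mu : R)
    (f : 'rV[R]_d -> R) : Prop :=
  forall (x y : 'rV[R]_d) (t : R), 0 <= t -> t <= 1 ->
    f (t *: x + (1 - t) *: y)
      <= t * f x + (1 - t) * f y
         - mu / 2 * t * (1 - t) * enorm (x - y) ^+ 2.

Definition average (R : realType) (d n : nat) (F : 'I_n -> 'rV[R]_d -> R)
    (x : 'rV[R]_d) : R :=
  n%:R^-1 * \sum_(i < n) F i x.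

Definition nice_sampling (R : realType) (n tau : nat) (A : {set 'I_n}) : R :=
  if #|A| == tau then ('C(n, tau))%:R^-1 else 0.

(* [S k] is drawn with probability mass function [p], independently of
   [S 0], ..., [S k.-1].  As the sets take finitely many values, every event of
   the past is of the form "the history [S 0, ..., S k.-1] lies in [H]". *)
Definition independent_draws (R : realType) (disp : measure_display)
    (T : measurableType disp) (P : probability T R) (n : nat)
    (p : {set 'I_n} -> R) (S : nat -> T -> {set 'I_n}) : Prop :=
  [/\ forall k A, measurable [set w | S k w = A],
      forall k A, P [set w | S k w = A] = (p A)%:E
    & forall k (B : set {set 'I_n}) (H : set {ffun 'I_k -> {set 'I_n}}),
        (P ([set w | B (S k w)]
            `&` [set w | H [ffun j : 'I_k => S j w]])
         = P [set w | B (S k w)]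
           * P [set w | H [ffun j : 'I_k => S j w]])%E].

Definition miso_point (R : realType) (d n : nat) (F : 'I_n -> 'rV[R]_d -> R)
    (gamma : R) (phi : 'I_n -> 'rV[R]_d) : 'rV[R]_d :=
  n%:R^-1 *: \sum_(i < n) phi i
  - (gamma / n%:R) *: \sum_(i < n) gradient (F i) (phi i).

Fixpoint miso_table (R : realType) (d n : nat) (F : 'I_n -> 'rV[R]_d -> R)
    (gamma : R) (phi0 : 'I_n -> 'rV[R]_d) (s : nat -> {set 'I_n}) (k : nat)
    : 'I_n -> 'rV[R]_d :=
  if k is k'.+1 then
    let phi := miso_table F gamma phi0 s k' in
    fun i => if i \in s k' then miso_point F gamma phi else phi i
  else phi0.

Definition miso_iterate (R : realType) (d n : nat)
    (F : 'I_n -> 'rV[R]_d -> R) (gamma : R) (phi0 : 'I_n -> 'rV[R]_d)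
    (s : nat -> {set 'I_n}) (k : nat) : 'rV[R]_d :=
  miso_point F gamma (miso_table F gamma phi0 s k).

(* Main.v *)
Require Import Defs.
From HB Require Import structures.
From mathcomp Require Import all_boot all_order all_algebra.
From mathcomp Require Import all_classical all_reals all_analysis.
From mathcomp Require Import measurable_realfun ring lra.

Set Implicit Arguments.
Unset Strict Implicit.
Unset Printing Implicit Defensive.

Import Order.TTheory GRing.Theory Num.Theory.
Import numFieldNormedType.Exports.

Local Open Scope classical_set_scope.
Local Open Scope ring_scope.

(** Write z_i = phi_i - gamma f_i'(phi_i), and z'_i for the same expression at
    xstar.  As the gradients f_i'(xstar) sum to 0, the residuals
    u_i = z_i - z'_i have mean x - xstar.  One step replaces u_i, for i in the
    drawn set, by (x - xstar) - gamma (f_i'(x) - f_i'(xstar)).  With q = tau/n,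
    the new iterate is therefore on average a gradient step of f with stepsize
    a = gamma q, and it fluctuates with the variance of a sum drawn without
    replacement, which only involves deviations from the mean.

    The proof follows the potential Psi = |x - xstar|^2 + 4 b V, where
    V is the sum of |u_i - mean u|^2 and b = (n - tau) / (n^2 (n - 1)).  The
    full sum W of |u_i|^2 would not do in place of V: W = V + n |x - xstar|^2,
    and its recursion feeds back a positive multiple of |x - xstar|^2, which
    strong convexity cannot absorb when mu is small.  In the recursion of V
    that feedback cancels, and V <= W suffices at the start.

    One step gives ([refresh_step], [potential_step])
      E Psi' <= |x - xstar - a f'(x)|^2 + 4 b (1 - q/2) V
                + 6 b q gamma^2 sum_i |f_i'(x) - f_i'(xstar)|^2.
    Let delta = f(x) - f(xstar).  For convex smooth functions the gradient
    differences are controlled by the gap ([sqr_gradient_gap]): the last sum is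
    at most 2 L n delta, and |f'(x)|^2 <= 2 Lf delta.  The stepsize is the one
    for which these two terms together cost exactly 2 a delta, which is what
    the strong convexity inequality
      <x - xstar, f'(x)> >= delta + mu/2 |x - xstar|^2
    pays for.  What remains is a contraction of the distance part by 1 - a mu
    and of the dispersion part by 1 - q/2; both are at most 1 - 1/(2 kappa),
    where kappa is the maximum in the statement ([potential_contraction]).
    The independence of the draws lets the contraction be iterated
    ([run_contraction]), and (1 - 1/T)^k <= exp(-k/T) concludes
    ([geometric_decay_le]).

    When the denominator of gamma is 0, Lf is 0, so f' vanishes identically and
    strong convexity forces every point to be xstar. *)

(** * The nice sampling *)

Lemma nice_ge0 (R : realType) (n tau : nat) (A : {set 'I_n}) :
  0 <= nice_sampling R tau A.
Proof. by rewrite /nice_sampling; case: ifP => // _; rewrite invr_ge0 ler0n. Qed.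

(** Complementation turns the supersets of [B] of size [tau] into the subsets of
    the complement of [B] of size [n - tau], which are counted by a binomial. *)
Lemma nice_superset (R : realType) (n tau : nat) (B : {set 'I_n}) :
  (tau <= n)%N ->
  \sum_(A : {set 'I_n}) nice_sampling R tau A * (B \subset A)%:R
  = 'C(n - #|B|, n - tau)%:R / 'C(n, tau)%:R.
Proof.
move=> taun.
have -> : 'C(n - #|B|, n - tau) =
    #|[set A : {set 'I_n} | (B \subset A) && (#|A| == tau)]%SET|.
  have -> : (n - #|B|)%N = #|(~: B)%SET| by rewrite [RHS]finset.cardsCs finset.setCK card_ord.
  rewrite -cards_draws -(card_imset _ (@finset.setC_inj 'I_n)); apply: eq_card => A.
  have hA : (#|(~: A)%SET| + #|A| = n)%N by rewrite addnC cardsC card_ord.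
  rewrite !inE; apply/imsetP/idP => [[D] | /andP[BA cA]].
    rewrite !inE => /andP[DB /eqP cD] ->.
    by rewrite -finset.setCS finset.setCK DB /= cardsCs finset.setCK card_ord cD subKn.
  exists (~: A); rewrite ?finset.setCK // inE finset.setCS BA /=.
  by rewrite -(eqP cA) -[X in (X - _)%N]hA addnK.
rewrite -sum1_card natr_sum mulr_suml.
rewrite [RHS]big_mkcond /=; apply: eq_bigr => A _; rewrite /nice_sampling !inE.
by case: (B \subset A); case: (_ == tau) => /=; rewrite ?mulr1 ?mulr0 ?mul1r ?mul0r.
Qed.

Lemma nice_total (R : realType) (n tau : nat) : (tau <= n)%N ->
  \sum_(A : {set 'I_n}) nice_sampling R tau A = 1.
Proof.
move=> taun; have := @nice_superset R n tau finset.set0 taun.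
rewrite cards0 subn0 bin_sub // divff ?pnatr_eq0 -?lt0n ?bin_gt0 // => <-.
by apply: eq_bigr => A _; rewrite finset.sub0set mulr1.
Qed.

Lemma nice_mem (R : realType) (n tau : nat) (i : 'I_n) : (tau <= n)%N ->
  \sum_(A : {set 'I_n}) nice_sampling R tau A * (i \in A)%:R
  = tau%:R / n%:R.
Proof.
move=> taun; have n0 : (0 < n)%N by case: n i {taun} => [[]|].
transitivity ('C(n - 1, n - tau)%:R / 'C(n, tau)%:R : R).
  rewrite -(cards1 i) -nice_superset //; apply: eq_bigr => A _.
  by rewrite finset.sub1set.
apply/eqP; rewrite eqr_div ?pnatr_eq0 -?lt0n ?bin_gt0 // -!natrM eqr_nat.
case: tau taun => [|tau] taun; first by rewrite subn0 bin_small // subn1 prednK.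
rewrite subn1 (_ : n - tau.+1 = n.-1 - tau)%N; last by rewrite subnS -subn1 subnAC subn1.
rewrite bin_sub; last by rewrite -ltnS prednK.
by rewrite mulnC mul_bin_diag.
Qed.

Lemma nice_mem2 (R : realType) (n tau : nat) (i j : 'I_n) :
  (tau <= n)%N -> i != j ->
  \sum_(A : {set 'I_n}) nice_sampling R tau A * ((i \in A) && (j \in A))%:R
  = tau%:R * (tau%:R - 1) / (n%:R * (n%:R - 1)).
Proof.
move=> taun ij; have c2 : #|[set i; j]%SET| = 2%N by rewrite cards2 ij.
have n1 : (1 < n)%N by rewrite -c2 -[n in (_ <= n)%N](card_ord n) max_card.
transitivity ('C(n - 2, n - tau)%:R / 'C(n, tau)%:R : R).
  rewrite -c2 -nice_superset //; apply: eq_bigr => A _.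
  by rewrite finset.subUset !finset.sub1set.
case: n i j n1 taun {ij c2} => [|[|m]] // _ _ _.
case: tau => [|[|tau]] taun.
- by rewrite subn0 bin_small ?mul0r // subSS subn1.
- by rewrite subrr mulr0 mul0r !subSS subn0 bin_small ?mul0r.
have pred k : k.+1%:R - 1 = k%:R :> R by rewrite -addn1 natrD addrK.
rewrite !subSS subn0 bin_sub // !pred -!natrM.
apply/eqP; rewrite eqr_div ?pnatr_eq0 -?lt0n ?bin_gt0 // -!natrM eqr_nat.
rewrite mulnC -mulnA mul_bin_diag mulnCA mul_bin_diag.
by rewrite mulnCA mulnA.
Qed.

Lemma nice_sum (R : realType) (n tau : nat) (v : 'I_n -> R) : (tau <= n)%N ->
  \sum_(A : {set 'I_n}) nice_sampling R tau A * (\sum_(i in A) v i)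
  = tau%:R / n%:R * \sum_i v i.
Proof.
move=> taun; rewrite mulr_sumr.
under eq_bigr => A _ do rewrite big_mkcond mulr_sumr.
rewrite exchange_big /=; apply: eq_bigr => i _.
rewrite -(@nice_mem R n tau i) // mulr_suml; apply: eq_bigr => A _.
by rewrite -mulrA; case: (i \in A); rewrite ?mul1r ?mul0r.
Qed.

(** The variance of a sum drawn without replacement, in the uncentered form: the
    two coefficients come from the inclusion probabilities of pairs, and the
    second one is the difference between [t / N] and the first. *)
Lemma nice_sum_sqr (R : realType) (n tau : nat) (v : 'I_n -> R) :
  (1 < n)%N -> (tau <= n)%N ->
  let N : R := n%:R in let t : R := tau%:R in
  \sum_(A : {set 'I_n}) nice_sampling R tau A * (\sum_(i in A) v i) ^+ 2
  = t * (t - 1) / (N * (N - 1)) * (\sum_i v i) ^+ 2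
    + t * (N - t) / (N * (N - 1)) * \sum_i v i ^+ 2.
Proof.
move=> n1 taun N t; set c := t * (t - 1) / (N * (N - 1)).
have N1 : N - 1 != 0 by rewrite subr_eq0 (eqr_nat R n 1) gtn_eqF.
have N0 : N != 0 by rewrite pnatr_eq0 -lt0n (ltn_trans _ n1).
(* [c + (i == j)%:R * (t / N - c)] is the probability that [i] and [j] are
   both drawn. *)
transitivity (\sum_i \sum_j (c + (i == j)%:R * (t / N - c)) * (v i * v j)).
  transitivity (\sum_(A : {set 'I_n}) \sum_i \sum_j
    nice_sampling R tau A * ((i \in A) && (j \in A))%:R * (v i * v j)).
    apply: eq_bigr => A _; rewrite expr2 big_mkcond mulr_suml mulr_sumr.
    apply: eq_bigr => i _; rewrite !mulr_sumr; apply: eq_bigr => j _.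
    by case: (i \in A); case: (j \in A); rewrite /= ?mulr1 ?mulr0 ?mul0r ?mulr0.
  rewrite exchange_big; apply: eq_bigr => i _.
  rewrite exchange_big; apply: eq_bigr => j _.
  rewrite -mulr_suml; congr (_ * _); case: eqVneq => [->|ij].
    under eq_bigr do rewrite andbb.
    by rewrite nice_mem // mul1r addrC subrK.
  by rewrite nice_mem2 // mul0r addr0.
have -> : t * (N - t) / (N * (N - 1)) = t / N - c by rewrite /c; field; rewrite N1 N0.
rewrite expr2 mulr_suml !mulr_sumr -big_split /=; apply: eq_bigr => i _.
under eq_bigr do rewrite mulrDl.
rewrite big_split /= !mulr_sumr; congr (_ + _).
rewrite (bigD1 i) //= eqxx mul1r big1 ?addr0 // => j ji.
by rewrite eq_sym (negPf ji) !mul0r.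
Qed.

(** * Mean and dispersion of a finite family *)

Definition mean (R : realType) (n : nat) (w : 'I_n -> R) : R :=
  n%:R^-1 * \sum_i w i.

Definition dispersion (R : realType) (n : nat) (w : 'I_n -> R) : R :=
  \sum_i (w i - mean w) ^+ 2.

Lemma dispersionE (R : realType) (n : nat) (w : 'I_n -> R) : (0 < n)%N ->
  dispersion w = \sum_i w i ^+ 2 - n%:R * mean w ^+ 2.
Proof.
move=> n0; have N0 : n%:R != 0 :> R by rewrite pnatr_eq0 -lt0n.
rewrite /dispersion; under eq_bigr do rewrite sqrrB.
rewrite big_split sumrB /= sumrMnl -mulr_suml sumr_const card_ord.
have -> : \sum_i w i = n%:R * mean w by rewrite /mean mulrA divff ?mul1r.
by rewrite -[_ ^+ 2 *+ n]mulr_natl; ring.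
Qed.

Lemma mean_affine (R : realType) (n : nat) (c : R) (w : 'I_n -> R) :
  (0 < n)%N -> mean (fun i => c + w i) = c + mean w.
Proof.
move=> n0; have N0 : n%:R != 0 :> R by rewrite pnatr_eq0 -lt0n.
by rewrite /mean big_split /= sumr_const card_ord -[c *+ n]mulr_natl mulrDr mulrA mulVf ?mul1r.
Qed.

Lemma meanD (R : realType) (n : nat) (v w : 'I_n -> R) :
  mean (fun i => v i + w i) = mean v + mean w.
Proof. by rewrite /mean big_split /= mulrDr. Qed.

Lemma meanZ (R : realType) (n : nat) (c : R) (w : 'I_n -> R) :
  mean (fun i => c * w i) = c * mean w.
Proof. by rewrite /mean -mulr_sumr mulrCA. Qed.

Lemma dispersion_ge0 (R : realType) (n : nat) (w : 'I_n -> R) :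
  0 <= dispersion w.
Proof. by apply: sumr_ge0 => i _; rewrite sqr_ge0. Qed.

(** Young's inequality, applied to the centered families. *)
Lemma dispersionD_le (R : realType) (n : nat) (v w : 'I_n -> R) :
  dispersion (fun i => v i + w i) <= 2 * dispersion v + 2 * dispersion w.
Proof.
rewrite /dispersion meanD !mulr_sumr -big_split /=; apply: ler_sum => i _.
set a := mean v; set b := mean w.
have := sqr_ge0 ((v i - a) - (w i - b)).
nra.
Qed.

Lemma dispersionZ (R : realType) (n : nat) (c : R) (w : 'I_n -> R) :
  dispersion (fun i => c * w i) = c ^+ 2 * dispersion w.
Proof.
rewrite /dispersion meanZ mulr_sumr; apply: eq_bigr => i _; ring.
Qed.

Lemma dispersion_shift (R : realType) (n : nat) (c : R) (w : 'I_n -> R) :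
  (0 < n)%N -> dispersion (fun i => c + w i) = dispersion w.
Proof.
move=> n0; rewrite /dispersion mean_affine //; apply: eq_bigr => i _; ring.
Qed.

(** * One refresh of a random subset *)

(** The effect of one step on one coordinate of the residuals; [g] stands for
    the gradient differences at the current iterate. *)
Definition refresh (R : realType) (n : nat) (gamma : R) (u g : 'I_n -> R)
    (A : {set 'I_n}) : 'I_n -> R :=
  fun i => if i \in A then mean u - gamma * g i else u i.

(** Only scalars occur here: squared Euclidean norms are sums over the
    coordinates, and everything below is applied coordinate by coordinate.
    The increments [v i = mean u - gamma * g i - u i] have mean
    [- gamma * mean g], so the mean of the refreshed family moves on average to
    [mean u - gamma * q * mean g], with variance [q * b * dispersion v].
    Subtracting [N] times the squared mean from the expected sum of squares
    leaves no multiple of [mean u ^+ 2] in the expected dispersion.  The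
    variance is at most
    [q * b * (2 * gamma ^+ 2 * dispersion g + 2 * dispersion u)], and the factor
    4 makes the decrease [4 * b * q] of the dispersion term pay for
    [2 * b * q] of it and still leave [2 * b * q]. *)
Lemma refresh_step (R : realType) (n tau : nat) (gamma : R)
    (u g : 'I_n -> R) : (1 < n)%N -> (tau <= n)%N ->
  let N : R := n%:R in let t : R := tau%:R in
  let q := t / N in let b := (N - t) / (N ^+ 2 * (N - 1)) in
  (\sum_(A : {set 'I_n}) nice_sampling R tau A *
    (mean (refresh gamma u g A) ^+ 2
     + 4 * b * dispersion (refresh gamma u g A))
  <= (mean u - gamma * q * mean g) ^+ 2
     + 4 * b * (1 - q / 2) * dispersion u
     + 6 * b * q * gamma ^+ 2 * \sum_i g i ^+ 2 : Prop).
Proof.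
move=> n1 taun N t q b; have n0 : (0 < n)%N by apply: ltn_trans n1.
have tN : t <= N by rewrite ler_nat.
have t0 : 0 <= t by rewrite ler0n.
have N1 : 1 < N by rewrite (ltr_nat R 1).
have b0 : 0 <= b.
  by rewrite divr_ge0 ?subr_ge0 // mulr_ge0 ?sqr_ge0 // subr_ge0 ltW.
have q0 : 0 <= q by rewrite divr_ge0 // ltW // (lt_trans _ N1).
have q1 : q <= 1 by rewrite ler_pdivrMr ?mul1r // (lt_trans _ N1).
have NN : N != 0 by rewrite gt_eqF // (lt_trans _ N1).
have N1N : N - 1 != 0 by rewrite subr_eq0 gt_eqF.
set e := mean u; pose v i := e - gamma * g i - u i.
pose X (A : {set 'I_n}) := N^-1 * \sum_(i in A) v i.
have meanr A : mean (refresh gamma u g A) = e + X A.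
  rewrite /e /mean /X -mulrDr; congr (_ * _).
  rewrite [X in _ = _ + X]big_mkcond -big_split /=; apply: eq_bigr => i _.
  by rewrite /refresh /v; case: (i \in A); rewrite ?addr0 // -/e; ring.
have meanv : mean v = - gamma * mean g.
  rewrite (_ : v = fun i => e + (- gamma * g i + -1 * u i)).
    by rewrite mean_affine // meanD !meanZ -/e; ring.
  by apply/funext => i; rewrite /v; ring.
have sumv : \sum_i v i = N * mean v by rewrite /mean mulrA divff ?mul1r.
have sumv2 : \sum_i v i ^+ 2 = dispersion v + N * mean v ^+ 2.
  by rewrite dispersionE // subrK.
have dispv : dispersion v <= 2 * gamma ^+ 2 * dispersion g + 2 * dispersion u.
  rewrite (_ : v = fun i => e + (- gamma * g i + -1 * u i)); last first.
    by apply/funext => i; rewrite /v; ring.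
  rewrite dispersion_shift //; apply: le_trans (dispersionD_le _ _) _.
  by rewrite !dispersionZ le_eqVlt; apply/orP; left; apply/eqP; ring.
have EX : \sum_A nice_sampling R tau A * (e + X A) ^+ 2
    = (e + q * mean v) ^+ 2 + q * b * dispersion v.
  transitivity (\sum_A (e ^+ 2 * nice_sampling R tau A +
      2 * e * N^-1 * (nice_sampling R tau A * \sum_(i in A) v i)
      + N ^- 2 * (nice_sampling R tau A * (\sum_(i in A) v i) ^+ 2))).
    by apply: eq_bigr => A _; rewrite /X; field.
  rewrite !big_split /= -!mulr_sumr nice_total // nice_sum // nice_sum_sqr //.
  rewrite -/N -/t sumv sumv2 /q /b; field.
  by rewrite NN N1N.
have ES : \sum_A nice_sampling R tau A * \sum_i refresh gamma u g A i ^+ 2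
    = (1 - q) * \sum_i u i ^+ 2 + q * \sum_i (e - gamma * g i) ^+ 2.
  transitivity (\sum_A (nice_sampling R tau A * \sum_i u i ^+ 2 +
    nice_sampling R tau A *
      \sum_(i in A) ((e - gamma * g i) ^+ 2 - u i ^+ 2))).
    apply: eq_bigr => A _; rewrite -mulrDr; congr (_ * _).
    rewrite [X in _ = _ + X]big_mkcond -big_split /=; apply: eq_bigr => i _.
    by rewrite /refresh -/e; case: (i \in A); rewrite ?addr0 // addrC subrK.
  rewrite big_split /= -mulr_suml nice_total // nice_sum // -/q sumrB; ring.
have Su : \sum_i u i ^+ 2 = dispersion u + N * e ^+ 2.
  by rewrite dispersionE // subrK.
have Sg : \sum_i g i ^+ 2 = dispersion g + N * mean g ^+ 2.
  by rewrite dispersionE // subrK.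
have Sge : \sum_i (e - gamma * g i) ^+ 2
    = gamma ^+ 2 * dispersion g + N * (e - gamma * mean g) ^+ 2.
  rewrite -[LHS](subrK (N * mean (fun i => e - gamma * g i) ^+ 2)).
  rewrite -dispersionE //.
  rewrite (_ : (fun i => e - gamma * g i) = fun i => e + (- gamma * g i)).
    by rewrite dispersion_shift // dispersionZ mean_affine // meanZ; ring.
  by apply/funext => i; ring.
have -> : \sum_A nice_sampling R tau A *
    (mean (refresh gamma u g A) ^+ 2 + 4 * b * dispersion (refresh gamma u g A))
  = (1 - 4 * b * N) * (\sum_A nice_sampling R tau A * (e + X A) ^+ 2)
    + 4 * b * \sum_A nice_sampling R tau A * \sum_i refresh gamma u g A i ^+ 2.
  rewrite !mulr_sumr -big_split /=; apply: eq_bigr => A _.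
  by rewrite dispersionE // meanr -/N; ring.
rewrite EX ES Su Sg Sge meanv.
have D0 := dispersion_ge0 v; have V0 := dispersion_ge0 u.
set D := dispersion v in dispv D0 *; set V := dispersion u in dispv V0 *.
set G := dispersion g in dispv *; set m := mean g.
have qb0 : 0 <= q * b by rewrite mulr_ge0.
have h1 : 0 <= q * b * (2 * gamma ^+ 2 * G + 2 * V - D).
  by rewrite mulr_ge0 // subr_ge0.
have h2 : 0 <= q * b * (N * (gamma * m) ^+ 2).
  by rewrite mulr_ge0 // mulr_ge0 ?sqr_ge0 ?ler0n.
have h3 : 0 <= q * b * (b * (N * D)).
  by apply: mulr_ge0 => //; apply: mulr_ge0 => //; apply: mulr_ge0; rewrite ?ler0n.
have h4 : 0 <= q * b * (q * (N * (gamma * m) ^+ 2)).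
  by rewrite mulr_ge0 // mulr_ge0 // mulr_ge0 ?sqr_ge0 ?ler0n.
(* The slack: the bound on the dispersion of [v], and nonnegative multiples of
   that dispersion and of [mean g ^+ 2] that the claim gives away. *)
rewrite -subr_ge0 [leRHS](_ : _ =
  q * b * (2 * gamma ^+ 2 * G + 2 * V - D)
  + 2 * (q * b * (N * (gamma * m) ^+ 2))
  + 4 * (q * b * (b * (N * D)))
  + 4 * (q * b * (q * (N * (gamma * m) ^+ 2)))); last by field.
by rewrite !addr_ge0 // mulr_ge0.
Qed.

(** * Gradients of smooth and convex functions *)

Definition dotv (R : realType) (d : nat) (u v : 'rV[R]_d) : R :=
  \sum_j u 0 j * v 0 j.

Lemma dotvC (R : realType) (d : nat) (u v : 'rV[R]_d) : dotv u v = dotv v u.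
Proof. by apply: eq_bigr => j _; rewrite mulrC. Qed.

Lemma dotvDl (R : realType) (d : nat) (u v w : 'rV[R]_d) :
  dotv (u + v) w = dotv u w + dotv v w.
Proof. by rewrite -big_split; apply: eq_bigr => j _; rewrite mxE mulrDl. Qed.

Lemma dotvZl (R : realType) (d : nat) (c : R) (u w : 'rV[R]_d) :
  dotv (c *: u) w = c * dotv u w.
Proof. by rewrite mulr_sumr; apply: eq_bigr => j _; rewrite mxE mulrA. Qed.

Lemma dotvDr (R : realType) (d : nat) (u v w : 'rV[R]_d) :
  dotv w (u + v) = dotv w u + dotv w v.
Proof. by rewrite !(dotvC w) dotvDl. Qed.

Lemma dotvZr (R : realType) (d : nat) (c : R) (u w : 'rV[R]_d) :
  dotv w (c *: u) = c * dotv w u.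
Proof. by rewrite !(dotvC w) dotvZl. Qed.

Lemma dotvNl (R : realType) (d : nat) (u w : 'rV[R]_d) :
  dotv (- u) w = - dotv u w.
Proof. by rewrite -scaleN1r dotvZl mulN1r. Qed.

Lemma dotvNr (R : realType) (d : nat) (u w : 'rV[R]_d) :
  dotv w (- u) = - dotv w u.
Proof. by rewrite !(dotvC w) dotvNl. Qed.

Definition dotvE := (dotvDl, dotvDr, dotvNl, dotvNr, dotvZl, dotvZr).

Lemma enorm_sqr (R : realType) (d : nat) (v : 'rV[R]_d) :
  enorm v ^+ 2 = dotv v v.
Proof.
rewrite sqr_sqrtr; first by apply: eq_bigr => j _; rewrite expr2.
by apply: sumr_ge0 => j _; rewrite sqr_ge0.
Qed.

Lemma enorm_ge0 (R : realType) (d : nat) (v : 'rV[R]_d) : 0 <= enorm v.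
Proof. exact: sqrtr_ge0. Qed.

Lemma enormZ (R : realType) (d : nat) (c : R) (v : 'rV[R]_d) :
  enorm (c *: v) = `|c| * enorm v.
Proof.
rewrite /enorm -sqrtr_sqr -sqrtrM ?sqr_ge0 //; congr Num.sqrt.
by rewrite mulr_sumr; apply: eq_bigr => j _; rewrite mxE exprMn.
Qed.

(** A weak form of the Cauchy-Schwarz inequality, in the shape that Lipschitz
    gradients call for.  If [0 < c] it follows from
    [0 <= dotv (u - c *: v) (u - c *: v)]; if [c = 0], then [u = 0]. *)
Lemma dotv_le (R : realType) (d : nat) (c : R) (u v : 'rV[R]_d) : 0 <= c ->
  enorm u <= c * enorm v -> dotv u v <= c * enorm v ^+ 2.
Proof.
move=> c0 uv.
have uv2 : dotv u u <= c ^+ 2 * dotv v v.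
  by rewrite -!enorm_sqr -exprMn ler_pXn2r // ?nnegrE ?mulr_ge0 // enorm_ge0.
have s0 : 0 <= dotv (u - c *: v) (u - c *: v) by rewrite -enorm_sqr sqr_ge0.
move: s0; rewrite !dotvE (dotvC v u) enorm_sqr => s0.
have [c00|cn0] := eqVneq c 0; last first.
  have cp : 0 < c by rewrite lt_neqAle eq_sym cn0.
  rewrite -(ler_pM2l cp); nra.
rewrite c00 mul0r.
suff -> : dotv u v = 0 by [].
have u0 : enorm u = 0 by apply/eqP; rewrite eq_le enorm_ge0 (le_trans uv) // c00 mul0r.
have {}u0 : \sum_j (u 0 j) ^+ 2 = 0.
  by have := enorm_sqr u; rewrite u0 expr0n /= /dotv => /esym e; rewrite -[RHS]e;
     apply: eq_bigr => j _; rewrite expr2.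
apply: big1 => j _; suff -> : u 0 j = 0 by rewrite mul0r.
apply/eqP; rewrite -sqrf_eq0; apply/eqP.
by apply: (psumr_eq0P _ u0) => // i _; rewrite sqr_ge0.
Qed.

Lemma diff_gradient (R : realType) (d : nat) (f : 'rV[R]_d -> R)
    (x h : 'rV[R]_d) : differentiable (f : 'rV[R]_d -> R^o) x ->
  'd (f : 'rV[R]_d -> R^o) x h = dotv (gradient f x) h.
Proof.
move=> df; rewrite [in LHS](row_sum_delta h) linear_sum.
by apply: eq_bigr => j _; rewrite linearZ /= mxE mulrC.
Qed.

(** The difference quotient of [f] restricted to a line is the directional
    difference quotient of [f], so no chain rule is needed. *)
Lemma derive_quotient_line (R : realType) (d : nat) (f : 'rV[R]_d -> R)
    (x h : 'rV[R]_d) (t : R) :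
  (fun s : R => s^-1 *:
    (((fun t : R => f (x + t *: h) : R^o) \o shift t) (s *: (1 : R^o)) - f (x + t *: h) : R^o))
  = (fun s : R => s^-1 *:
      (((f : 'rV[R]_d -> R^o) \o shift (x + t *: h)) (s *: h) - f (x + t *: h))).
Proof.
apply/funext => s /=; congr (_ *: (f _ - _)).
by rewrite [_ *: 1]mulr1 scalerDl addrCA.
Qed.

Lemma is_derive_line (R : realType) (d : nat) (f : 'rV[R]_d -> R)
    (x h : 'rV[R]_d) (t : R) :
  (forall y, differentiable (f : 'rV[R]_d -> R^o) y) ->
  is_derive (t : R^o) (1 : R^o) (fun t : R^o => f (x + t *: h) : R^o)
    (dotv (gradient f (x + t *: h)) h).
Proof.
move=> df; have dv := @diff_derivable _ _ _ _ _ h (df (x + t *: h)).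
split; first by rewrite /derivable derive_quotient_line.
by rewrite /derive derive_quotient_line -[LHS]/('D_h _ _) deriveE // diff_gradient.
Qed.

(** Divide the convexity inequality between [x] and [x + s *: (y - x)] by [s]
    and let [s] tend to 0 from the right. *)
Lemma gradient_lower_bound (R : realType) (d : nat) (m : R)
    (f : 'rV[R]_d -> R) (x y : 'rV[R]_d) :
  (forall y, differentiable (f : 'rV[R]_d -> R^o) y) ->
  strongly_convex m f ->
  f x + dotv (gradient f x) (y - x) + m / 2 * enorm (y - x) ^+ 2 <= f y.
Proof.
move=> df cf; set h := y - x; set K := m / 2 * _.
have [dv ev] := is_derive_line x h 0 df.
move: dv ev; rewrite /derivable /derive scale0r addr0 => dv ev.
set q := (fun s => s^-1 *: _) in dv ev.
have q_cvg : q s - K * s @[s --> 0^'+] --> dotv (gradient f x) h - K * 0.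
  apply: cvgB; last first.
    apply: cvgM; first exact: cvg_cst.
    exact: cvg_at_right_filter.
  rewrite -ev; apply: cvg_dnbhs_at_right. exact: dv.
suff : dotv (gradient f x) h - K * 0 <= f y - f x - K by lra.
rewrite -(cvg_lim _ q_cvg) //; apply: limr_le; first by apply: cvgP q_cvg.
near=> s.
have s0 : 0 < s by near: s; exact: nbhs_right_gt.
have s1 : s <= 1 by near: s; exact: nbhs_right_le.
have := cf y x s (ltW s0) s1.
rewrite /q /= [_ *: 1]mulr1 addr0 -/h.
have -> : x + s *: h = s *: y + (1 - s) *: x.
  by apply/matrixP => i j; rewrite /h !mxE; ring.
move=> cs; rewrite /GRing.scale /= -(ler_pM2l s0) mulrBr mulrA divff ?gt_eqF // mul1r.
by rewrite -/h in cs; rewrite /K; nra.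
Unshelve. all: by end_near. Qed.

Lemma convex_function_strongly_convex0 (R : realType) (d : nat) (f : 'rV[R]_d -> R) :
  convex_function [set: 'rV[R]_d] f -> strongly_convex 0 f.
Proof.
move=> cf x y t t0 t1.
have := cf (Itv01 t0 t1) x y; rewrite !inE => /(_ I I).
by rewrite !mul0r subr0.
Qed.

(** Along the segment, [psi] below is [f] minus its quadratic upper model; the
    Lipschitz bound makes its derivative nonpositive. *)
Lemma smooth_descent (R : realType) (d : nat) (L : R) (f : 'rV[R]_d -> R)
    (x h : 'rV[R]_d) : smooth_fun L f ->
  f (x + h) <= f x + dotv (gradient f x) h + L / 2 * enorm h ^+ 2.
Proof.
move=> [L0 df Lf]; set K := L / 2 * _; set D := dotv _ _.
pose psi (t : R^o) : R^o := f (x + t *: h) - t * D - t ^+ 2 * K.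
pose dpsi (t : R) : R := dotv (gradient f (x + t *: h)) h - D - 2 * t * K.
have psi_der (t : R^o) : is_derive t (1 : R^o) psi (dpsi t).
  have dline := is_derive_line x h t df.
  rewrite /psi /dpsi; apply: is_derive_eq.
  by rewrite /GRing.scale /=; ring.
have [t t01] : exists2 c, c \in `[0, 1]%R & psi 1 - psi 0 = dpsi c * (1 - 0).
  apply: MVT_segment => //; apply: continuous_subspaceT => t.
  by apply: differentiable_continuous; apply/derivable1_diffP; case: (psi_der t).
suff : dpsi t <= 0.
  rewrite /psi /= scale0r scale1r addr0 !expr2; lra.
move: t01; rewrite in_itv /= => /andP[t0 t1].
have : dotv (gradient f (x + t *: h) - gradient f x) h <= L * t * enorm h ^+ 2.
  apply: dotv_le; first exact: mulr_ge0.
  apply: le_trans (Lf _ _) _.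
  by rewrite addrAC subrr add0r enormZ ger0_norm // mulrA.
rewrite !dotvE /dpsi /D /K -mulrA => le_t; rewrite subr_le0.
by apply: le_trans le_t _; rewrite le_eqVlt; apply/orP; left; apply/eqP; field.
Qed.

(** If [f] lies above the affine function of slope [p] through [(y, f y)], then
    so it does at the point reached from [x] by a step along
    [gradient f x - p]; by [smooth_descent] that step decreases [f] enough to
    bound the gradient.  With [p = gradient f y] this is the cocoercivity of
    convex smooth functions, with [p = 0] the bound at a minimizer. *)
Lemma sqr_gradient_gap (R : realType) (d : nat) (L : R) (f : 'rV[R]_d -> R)
    (p x y : 'rV[R]_d) : smooth_fun L f ->
  (forall z, f y + dotv p (z - y) <= f z) ->
  enorm (gradient f x - p) ^+ 2 <= 2 * L * (f x - f y - dotv p (x - y)).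
Proof.
move=> fL lb; have L0 : 0 <= L by case: fL.
set g := gradient f x - p; set D := _ - dotv _ _.
(* Compare the two bounds at [x - c *: g]. *)
have step (c : R) : c * enorm g ^+ 2 <= D + L / 2 * (c ^+ 2 * enorm g ^+ 2).
  have := lb (x + - c *: g); have := smooth_descent x (- c *: g) fL.
  have -> : gradient f x = g + p by rewrite subrK.
  rewrite [x + - c *: g - y]addrAC !enorm_sqr !dotvE /D !dotvE.
  lra.
have D0 : 0 <= D by have := step 0; rewrite !mul0r expr0n /= mul0r mulr0 addr0.
have [L00|Ln0] := eqVneq L 0; last first.
  have Lp : 0 < L by rewrite lt_neqAle eq_sym Ln0.
  have half (G : R) : L / 2 * (L^-1 ^+ 2 * G) = L^-1 * G / 2 by field.
  have sL : L^-1 * enorm g ^+ 2 <= 2 * D by have := step L^-1; rewrite half; lra.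
  by rewrite [2 * L]mulrC -mulrA -ler_pdivrMl.
(* For [L = 0] arbitrarily long steps are allowed; the one chosen here would
   give [D + 1 <= D]. *)
have [->|gn0] := eqVneq (enorm g ^+ 2) 0; first by rewrite !mulr_ge0.
have := step ((D + 1) / enorm g ^+ 2).
rewrite L00 divfK // !mul0r addr0; lra.
Qed.

Lemma gradient_average (R : realType) (d n : nat) (F : 'I_n -> 'rV[R]_d -> R)
    (x : 'rV[R]_d) :
  (forall i y, differentiable (F i : 'rV[R]_d -> R^o) y) ->
  gradient (average F) x = n%:R^-1 *: \sum_i gradient (F i) x.
Proof.
move=> dF; apply/rowP => j; rewrite !mxE summxE.
have -> : average F = n%:R^-1 \*: (\sum_(i < n) (F i : 'rV[R]_d -> R^o)).
  by apply/funext => y; rewrite /average /= fct_sumE.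
rewrite -deriveE; last by apply: differentiableZ; apply: differentiable_sum.
have dv i : derivable (F i : 'rV[R]_d -> R^o) x (delta_mx 0 j).
  exact: diff_derivable.
rewrite deriveZ; last exact: derivable_sum.
rewrite derive_sum //; congr (_ * _); apply: eq_bigr => i _.
by rewrite mxE deriveE.
Qed.

(** * Runs driven by independent draws *)

Lemma expectation_finite (R : realType) (disp : measure_display)
    (T : measurableType disp) (P : probability T R) (I : finType) (X : T -> I)
    (g : I -> R) :
  (forall i, measurable [set w | X w = i]) -> (forall i, 0 <= g i) ->
  ('E_P[(fun w => g (X w))] = \sum_(i : I) (g i)%:E * P [set w | X w = i])%E.
Proof.
move=> mX g0; rewrite unlock.
transitivity (\int[P]_w \sum_(i : I) ((g i)%:E * (\1_[set w | X w = i] w)%:E))%E.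
  apply: eq_integral => w _; rewrite (bigD1 (X w)) //= big1 ?adde0.
    by rewrite indicE mem_set // mule1.
  by move=> i iX; rewrite indicE memNset ?mule0 // => /= e; rewrite e eqxx in iX.
rewrite ge0_integral_sum //=.
- apply: eq_bigr => i _; rewrite ge0_integralZl_EFin //.
  + by rewrite integral_indic // setIT.
  + exact/measurable_EFinP/measurable_indic.
- by move=> i; apply: measurable_funeM; exact/measurable_EFinP/measurable_indic.
- by move=> i w _; rewrite mule_ge0 ?lee_fin // indicE.
Qed.

Fixpoint run (X I : Type) (step : I -> X -> X) (x0 : X) (s : nat -> I)
    (k : nat) : X :=
  if k is k'.+1 then step (s k') (run step x0 s k') else x0.

Lemma run_prefix (X I : Type) (step : I -> X -> X) (x0 : X) (s s' : nat -> I)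
    (k : nat) : (forall j, (j < k)%N -> s j = s' j) ->
  run step x0 s k = run step x0 s' k.
Proof.
elim: k => //= k IH ss'; rewrite ss' // IH // => j jk.
by apply: ss'; apply: ltnW.
Qed.

Lemma history_measurable (R : realType) (disp : measure_display)
    (T : measurableType disp) (P : probability T R) (n : nat)
    (p : {set 'I_n} -> R) (S : nat -> T -> {set 'I_n}) (k : nat)
    (h : {ffun 'I_k -> {set 'I_n}}) : independent_draws P p S ->
  measurable [set w | [ffun j : 'I_k => S j w] = h].
Proof.
move=> [mS _ _].
rewrite (_ : [set w | _] =
  \bigcap_(j in [set: 'I_k]) [set w | S j w = h j]).
  by apply: fin_bigcap_measurable => // j _; exact: mS.
apply/seteqP; split => w /= => [<- j _ /=|Sh]; first by rewrite ffunE.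
by apply/ffunP => j; rewrite ffunE; exact: Sh.
Qed.

(** Averaging over the draw [S k] first, with the past fixed: the tower property
    for a draw independent of a finite history. *)
Lemma expectation_fresh_draw (R : realType) (disp : measure_display)
    (T : measurableType disp) (P : probability T R) (n : nat)
    (p : {set 'I_n} -> R) (S : nat -> T -> {set 'I_n}) (k : nat)
    (g : {set 'I_n} -> {ffun 'I_k -> {set 'I_n}} -> R) :
  independent_draws P p S -> (forall A, 0 <= p A) ->
  (forall A h, 0 <= g A h) ->
  ('E_P[(fun w => g (S k w) [ffun j : 'I_k => S j w])%R]
   = 'E_P[(fun w => \sum_A p A * g A [ffun j : 'I_k => S j w])%R])%E.
Proof.
move=> hS p0 g0; have [mS pS iS] := hS.
have mH h := history_measurable (k := k) h hS.
have pair A h : [set w | (S k w, [ffun j : 'I_k => S j w]) = (A, h)] =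
    [set w | S k w = A] `&` [set w | [ffun j : 'I_k => S j w] = h].
  by apply/seteqP; split => w /= [-> ->].
have -> : (fun w => g (S k w) [ffun j : 'I_k => S j w]) =
    (fun w => (fun z => g z.1 z.2) (S k w, [ffun j : 'I_k => S j w])) by [].
rewrite (@expectation_finite _ _ _ P _
  (fun w => (S k w, [ffun j : 'I_k => S j w])) (fun z => g z.1 z.2)) //; last first.
  by move=> [A h]; rewrite pair; exact: measurableI.
rewrite (@expectation_finite _ _ _ P _ (fun w => [ffun j : 'I_k => S j w])
  (fun h => \sum_A p A * g A h)) //; last first.
  by move=> h; apply: sumr_ge0 => A _; rewrite mulr_ge0.
rewrite (eq_bigr (fun z => ((g z.1 z.2)%:E *
  P [set w | (S k w, [ffun j : 'I_k => S j w]) = (z.1, z.2)])%E)); last by case.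
rewrite -(pair_bigA _ (fun A h => (g A h)%:E *
  P [set w | (S k w, [ffun j : 'I_k => S j w]) = (A, h)]))%E /=.
rewrite exchange_big /=; apply: eq_bigr => h _.
rewrite -sumEFin ge0_sume_distrl; last first.
  by move=> A _; rewrite lee_fin mulr_ge0.
apply: eq_bigr => A _.
rewrite pair (iS k [set A]%classic [set h]%classic) pS muleA; congr (_ * _)%E.
by rewrite -EFinM mulrC.
Qed.

Lemma expectation_le_scale (R : realType) (disp : measure_display)
    (T : measurableType disp) (P : probability T R) (I : finType) (X : T -> I)
    (g g' : I -> R) (c : R) :
  (forall i, measurable [set w | X w = i]) -> (forall i, 0 <= g i) ->
  (forall i, 0 <= g' i) -> 0 <= c -> (forall i, g i <= c * g' i) ->
  ('E_P[(fun w => g (X w))] <= c%:E * 'E_P[(fun w => g' (X w))])%E.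
Proof.
move=> mX g0 g'0 c0 gg'; rewrite !expectation_finite // ge0_sume_distrr.
  by apply: lee_sum => i _; rewrite muleA -EFinM lee_wpmul2r // lee_fin.
by move=> i _; rewrite mule_ge0 ?lee_fin.
Qed.

(** The state after [k] steps depends on the first [k] draws only, so it factors
    through a finite type, where expectations are finite sums. *)
Definition run_history (n : nat) (X : Type) (step : {set 'I_n} -> X -> X)
    (x0 : X) (k : nat) (h : {ffun 'I_k -> {set 'I_n}}) : X :=
  run step x0 (fun j => if insub j is Some i then h i else finset.set0) k.

Lemma run_historyE (n : nat) (X : Type) (step : {set 'I_n} -> X -> X)
    (x0 : X) (k : nat) (s : nat -> {set 'I_n}) :
  run step x0 s k = run_history step x0 [ffun j : 'I_k => s j].
Proof. by apply: run_prefix => j jk; rewrite insubT ffunE. Qed.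

Lemma run_expectation_le (R : realType) (disp : measure_display)
    (T : measurableType disp) (P : probability T R) (n : nat)
    (p : {set 'I_n} -> R) (S : nat -> T -> {set 'I_n})
    (X : Type) (step : {set 'I_n} -> X -> X) (x0 : X) (U V : X -> R) (c : R)
    (k : nat) :
  independent_draws P p S -> (forall x, 0 <= U x) -> (forall x, 0 <= V x) ->
  0 <= c -> (forall x, U x <= c * V x) ->
  ('E_P[(fun w => U (run step x0 (S^~ w) k))]
   <= c%:E * 'E_P[(fun w => V (run step x0 (S^~ w) k))])%E.
Proof.
move=> hS U0 V0 c0 UV.
have runE (f : X -> R) : (fun w => f (run step x0 (S^~ w) k)) =
    (fun w => (f \o @run_history _ _ step x0 k) [ffun j : 'I_k => S j w]).
  by apply/funext => w; rewrite /= run_historyE.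
rewrite !runE.
have mH h := history_measurable (k := k) h hS.
apply: (expectation_le_scale P mH) => // h /=; [exact: U0|exact: V0|exact: UV].
Qed.

(** A potential that a single draw contracts in expectation decays
    geometrically along the run. *)
Lemma run_contraction (R : realType) (disp : measure_display)
    (T : measurableType disp) (P : probability T R) (n : nat)
    (p : {set 'I_n} -> R) (S : nat -> T -> {set 'I_n})
    (X : Type) (step : {set 'I_n} -> X -> X) (x0 : X) (V : X -> R) (c : R) :
  independent_draws P p S -> (forall A, 0 <= p A) -> (forall x, 0 <= V x) ->
  0 <= c -> (forall x, \sum_A p A * V (step A x) <= c * V x) ->
  forall k, ('E_P[(fun w => V (run step x0 (S^~ w) k))]
             <= (c ^+ k * V x0)%:E)%E.
Proof.
move=> hS p0 V0 c0 Vstep; elim=> [|k IH].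
  by rewrite /= expr0 mul1r expectation_cst.
have -> : (fun w => V (run step x0 (S^~ w) k.+1)) =
    (fun w => (fun A h => V (step A (run_history step x0 h)))
       (S k w) [ffun j : 'I_k => S j w]).
  by apply/funext => w /=; rewrite run_historyE.
rewrite (expectation_fresh_draw
  (g := fun A h => V (step A (run_history step x0 h))) hS) //.
rewrite (_ : (fun w => \sum_A _) =
    (fun w => \sum_A p A * V (step A (run step x0 (S^~ w) k)))); last first.
  by apply/funext => w; apply: eq_bigr => A _; rewrite run_historyE.
have avg0 x : 0 <= \sum_A p A * V (step A x).
  by apply: sumr_ge0 => A _; rewrite mulr_ge0.
apply: le_trans (run_expectation_le step x0 k hS avg0 V0 c0 Vstep) _.
by rewrite exprS -mulrA EFinM lee_wpmul2l ?lee_fin.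
Qed.

(** * The potential of minibatch MISO *)

Definition residual (R : realType) (d n : nat) (F : 'I_n -> 'rV[R]_d -> R)
    (gamma : R) (xs : 'rV[R]_d) (phi : 'I_n -> 'rV[R]_d) (i : 'I_n)
    : 'rV[R]_d :=
  phi i - xs - gamma *: gradient (F i) (phi i) + gamma *: gradient (F i) xs.

(** This is |x - xs|^2 + alpha * V of the introduction, written as a sum over
    coordinates so that [refresh_step] applies to each term. *)
Definition potential (R : realType) (d n : nat) (F : 'I_n -> 'rV[R]_d -> R)
    (gamma : R) (xs : 'rV[R]_d) (alpha : R) (phi : 'I_n -> 'rV[R]_d) : R :=
  \sum_j (mean (fun i => residual F gamma xs phi i 0 j) ^+ 2
          + alpha * dispersion (fun i => residual F gamma xs phi i 0 j)).

Definition miso_step (R : realType) (d n : nat) (F : 'I_n -> 'rV[R]_d -> R)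
    (gamma : R) (A : {set 'I_n}) (phi : 'I_n -> 'rV[R]_d)
    : 'I_n -> 'rV[R]_d :=
  fun i => if i \in A then miso_point F gamma phi else phi i.

Lemma miso_tableE (R : realType) (d n : nat) (F : 'I_n -> 'rV[R]_d -> R)
    (gamma : R) (phi0 : 'I_n -> 'rV[R]_d) (s : nat -> {set 'I_n}) (k : nat) :
  miso_table F gamma phi0 s k = run (miso_step F gamma) phi0 s k.
Proof. by elim: k => //= k ->. Qed.

(** The optimality condition removes the mean of the gradients at [xs], so the
    iterate is a mean of the table and its error is the mean residual. *)
Lemma mean_residual (R : realType) (d n : nat) (F : 'I_n -> 'rV[R]_d -> R)
    (gamma : R) (xs : 'rV[R]_d) (phi : 'I_n -> 'rV[R]_d) (j : 'I_d) :
  (0 < n)%N -> \sum_i gradient (F i) xs = 0 ->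
  mean (fun i => residual F gamma xs phi i 0 j)
  = (miso_point F gamma phi - xs) 0 j.
Proof.
move=> n0 opt; have N0 : n%:R != 0 :> R by rewrite pnatr_eq0 -lt0n.
have optj : mean (fun i => gradient (F i) xs 0 j) = 0.
  by rewrite /mean -summxE opt mxE mulr0.
have lin c (v w w' : 'I_n -> R) : mean (fun i => c + (v i + (- gamma * w i
    + gamma * w' i))) = c + (mean v + (- gamma * mean w + gamma * mean w')).
  by rewrite mean_affine // 2!meanD 2!meanZ.
transitivity (- xs 0 j + (mean (fun i => phi i 0 j) +
  (- gamma * mean (fun i => gradient (F i) (phi i) 0 j)
   + gamma * 0))).
  rewrite -[X in gamma * X]optj -lin; congr mean; apply/funext => i; rewrite /residual.
  move: (gradient _ (phi i)) (gradient _ xs) => v w; rewrite !mxE; ring.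
rewrite /mean /miso_point mulr0 addr0 -summxE -summxE.
move: (\sum_i phi i) (\sum_i gradient _ _) => v w; rewrite !mxE; ring.
Qed.

(** [refresh_step] summed over the coordinates, with the means identified as the
    error of the iterate and the gradient of the average. *)
Lemma potential_step (R : realType) (d n tau : nat)
    (F : 'I_n -> 'rV[R]_d -> R) (gamma : R) (xs : 'rV[R]_d)
    (phi : 'I_n -> 'rV[R]_d) :
  (1 < n)%N -> (tau <= n)%N -> \sum_i gradient (F i) xs = 0 ->
  (forall i y, differentiable (F i : 'rV[R]_d -> R^o) y) ->
  let N : R := n%:R in let t : R := tau%:R in
  let q := t / N in let b := (N - t) / (N ^+ 2 * (N - 1)) in
  let x := miso_point F gamma phi in
  (\sum_(A : {set 'I_n}) nice_sampling R tau A *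
    potential F gamma xs (4 * b) (miso_step F gamma A phi)
  <= enorm (x - xs - (gamma * q) *: gradient (average F) x) ^+ 2
     + (1 - q / 2) * (potential F gamma xs (4 * b) phi - enorm (x - xs) ^+ 2)
     + 6 * b * q * gamma ^+ 2 *
       \sum_i enorm (gradient (F i) x - gradient (F i) xs) ^+ 2 : Prop).
Proof.
move=> n1 taun opt dF N t q b x; have n0 : (0 < n)%N by apply: ltn_trans n1.
pose u j i := residual F gamma xs phi i 0 j.
pose g j i := (gradient (F i) x - gradient (F i) xs) 0 j.
have mu_ j : mean (u j) = (x - xs) 0 j by exact: mean_residual.
have mg j : mean (g j) = gradient (average F) x 0 j.
  rewrite gradient_average // mxE summxE /mean; congr (_ * _).
  rewrite -[RHS]subr0 -[X in _ - X](_ : (\sum_i gradient (F i) xs) 0 j = _).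
    rewrite summxE -sumrB; apply: eq_bigr => i _; rewrite /g.
    by move: (gradient _ x) (gradient _ xs) => v w; rewrite !mxE.
  by rewrite opt mxE.
have ref A j : (fun i => residual F gamma xs (miso_step F gamma A phi) i 0 j)
    = refresh gamma (u j) (g j) A.
  apply/funext => i; rewrite /refresh mu_ /residual /miso_step -/x.
  case: ifP => // _; rewrite /g.
  move: (gradient _ x) (gradient _ xs) => v w; rewrite !mxE; ring.
have := ler_sum (index_enum 'I_d) (P := predT)
  (fun j _ => refresh_step gamma (u j) (g j) n1 taun).
rewrite exchange_big /= -/N -/t -/q -/b => le1.
apply: le_trans (le_trans _ le1) _.
  apply: ler_sum => A _; rewrite /potential mulr_sumr.
  by apply: ler_sum => j _; rewrite ref.
rewrite !big_split /= !enorm_sqr.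
have -> : dotv (x - xs - (gamma * q) *: gradient (average F) x)
    (x - xs - (gamma * q) *: gradient (average F) x) =
  \sum_j (mean (u j) - gamma * q * mean (g j)) ^+ 2.
  apply: eq_bigr => j _; rewrite mu_ mg -expr2.
  by move: (gradient _ x) => v; rewrite !mxE.
have -> : \sum_i enorm (gradient (F i) x - gradient (F i) xs) ^+ 2 =
    \sum_j \sum_i g j i ^+ 2.
  rewrite exchange_big; apply: eq_bigr => i _; rewrite enorm_sqr.
  by apply: eq_bigr => j _; rewrite expr2.
have -> : dotv (x - xs) (x - xs) = \sum_j mean (u j) ^+ 2.
  by apply: eq_bigr => j _; rewrite mu_ expr2.
rewrite /potential big_split /= -/(u _) -!mulr_sumr; nra.
Qed.

Lemma potential_ge (R : realType) (d n : nat) (F : 'I_n -> 'rV[R]_d -> R)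
    (gamma : R) (xs : 'rV[R]_d) (alpha : R) (phi : 'I_n -> 'rV[R]_d) :
  (0 < n)%N -> \sum_i gradient (F i) xs = 0 -> 0 <= alpha ->
  enorm (miso_point F gamma phi - xs) ^+ 2 <= potential F gamma xs alpha phi.
Proof.
move=> n0 opt a0; rewrite enorm_sqr; apply: ler_sum => j _.
by rewrite mean_residual // expr2 lerDl mulr_ge0 // dispersion_ge0.
Qed.

(** The dispersion is at most the sum of the squares, which is how the initial
    value of the potential is compared with the one given by the residuals. *)
Lemma potential_le (R : realType) (d n : nat) (F : 'I_n -> 'rV[R]_d -> R)
    (gamma : R) (xs : 'rV[R]_d) (alpha : R) (phi : 'I_n -> 'rV[R]_d) :
  (0 < n)%N -> \sum_i gradient (F i) xs = 0 -> 0 <= alpha ->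
  potential F gamma xs alpha phi <= enorm (miso_point F gamma phi - xs) ^+ 2
    + alpha * \sum_i enorm (residual F gamma xs phi i) ^+ 2.
Proof.
move=> n0 opt a0; rewrite enorm_sqr.
under [in leRHS]eq_bigr do rewrite enorm_sqr.
rewrite exchange_big mulr_sumr -big_split; apply: ler_sum => j _ /=.
rewrite mean_residual // expr2 lerD2l ler_wpM2l // dispersionE //.
under [in leRHS]eq_bigr do rewrite -expr2.
by rewrite gerBl mulr_ge0 ?ler0n // sqr_ge0.
Qed.

(** * Minimizing a finite sum *)

Section FiniteSum.
Context (R : realType) (d n : nat) (F : 'I_n -> 'rV[R]_d -> R).
Context (mu Lf L : R) (xs : 'rV[R]_d).
Context (n0 : (0 < n)%N).
Context (cf : strongly_convex mu (average F)).
Context (sf : smooth_fun Lf (average F)).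
Context (xs_min : forall y, average F xs <= average F y).
Context (cF : forall i, convex_function [set: 'rV[R]_d] (F i)).
Context (sF : forall i, smooth_fun L (F i)).

Let N0 : n%:R != 0 :> R. Proof. by rewrite pnatr_eq0 -lt0n. Qed.

Let dF i y : differentiable (F i : 'rV[R]_d -> R^o) y.
Proof. by case: (sF i). Qed.

Lemma gradient_average_sqr_le x :
  enorm (gradient (average F) x) ^+ 2 <= 2 * Lf * (average F x - average F xs).
Proof.
have lb z : average F xs + dotv 0 (z - xs) <= average F z.
  rewrite /dotv big1 ?addr0 // => j _; by rewrite mxE mul0r.
have := sqr_gradient_gap x sf lb.
by rewrite subr0 [dotv 0 _]big1 ?subr0 // => j _; rewrite mxE mul0r.
Qed.

(** Fermat's rule, as the case [x = xs] of [gradient_average_sqr_le]. *)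
Lemma gradient_minimizer : \sum_i gradient (F i) xs = 0.
Proof.
have : enorm (gradient (average F) xs) ^+ 2 <= 0.
  by have := gradient_average_sqr_le xs; rewrite subrr mulr0.
rewrite enorm_sqr => le0.
have /psumr_eq0P z : \sum_j (gradient (average F) xs 0 j) ^+ 2 = 0.
  apply/eqP; rewrite eq_le sumr_ge0 ?andbT => [|j _]; last exact: sqr_ge0.
  by apply: le_trans le0; apply: ler_sum => j _; rewrite expr2.
have gz : gradient (average F) xs = 0.
  apply/rowP => j; rewrite [RHS]mxE; apply/eqP; rewrite -sqrf_eq0.
  by apply/eqP; apply: z => // i _; exact: sqr_ge0.
rewrite gradient_average // in gz.
by apply/eqP; move/eqP: gz; rewrite scaler_eq0 invr_eq0 (negPf N0).
Qed.

(** Strong convexity at [x], tested at the minimizer. *)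
Lemma gradient_average_dotv_ge x :
  average F x - average F xs + mu / 2 * enorm (x - xs) ^+ 2
  <= dotv (x - xs) (gradient (average F) x).
Proof.
have df : forall y, differentiable (average F : 'rV[R]_d -> R^o) y by case: sf.
have := gradient_lower_bound x xs df cf.
have -> : xs - x = - (x - xs) by rewrite opprB.
rewrite !enorm_sqr !dotvNl !dotvNr opprK (dotvC _ (gradient _ _)).
move: (dotv (x - xs) _) (dotv _ _) (average _ _) (average _ _).
move=> a b u v; lra.
Qed.

(** Cocoercivity of each component with respect to [xs]; the linear terms cancel
    in the sum because the gradients at [xs] sum to 0. *)
Lemma sum_gradient_sqr_le x :
  \sum_i enorm (gradient (F i) x - gradient (F i) xs) ^+ 2
  <= 2 * L * n%:R * (average F x - average F xs).
Proof.
apply: (@le_trans _ _ (\sum_i (2 * L * (F i x - F i xs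
    - dotv (gradient (F i) xs) (x - xs))))).
  apply: ler_sum => i _; apply: sqr_gradient_gap => // z.
  have := gradient_lower_bound xs z (dF i) (convex_function_strongly_convex0 (cF i)).
  by rewrite mul0r mul0r addr0.
rewrite -mulr_sumr !sumrB.
have -> : \sum_i dotv (gradient (F i) xs) (x - xs) = 0.
  transitivity (dotv (\sum_i gradient (F i) xs) (x - xs)).
    rewrite /dotv exchange_big; apply: eq_bigr => j _.
    by rewrite summxE mulr_suml.
  by rewrite gradient_minimizer /dotv big1 // => j _; rewrite mxE mul0r.
rewrite /average subr0 le_eqVlt; apply/orP; left; apply/eqP.
by field.
Qed.

End FiniteSum.

(** * Contraction and complexity *)

(** [D] is the inner product of the error with the gradient, [dl] the gap in
    function value and [E] the variance contribution of the component
    gradients: the terms in [dl] cancel exactly. *)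
Lemma contraction_arith (R : realFieldType)
    (r2 Psi D G2 dl E a q rho mu Lf : R) :
  0 <= r2 -> r2 <= Psi -> 0 <= a -> dl + mu / 2 * r2 <= D ->
  G2 <= 2 * Lf * dl -> E <= (2 * a - 2 * a ^+ 2 * Lf) * dl ->
  rho <= q / 2 -> rho <= a * mu ->
  r2 - 2 * a * D + a ^+ 2 * G2 + (1 - q / 2) * (Psi - r2) + E
  <= (1 - rho) * Psi.
Proof.
move=> r20 r2Psi a0 Dge G2le Ele rho1 rho2.
have h1 : 0 <= (a * mu - rho) * r2 by rewrite mulr_ge0 ?subr_ge0.
have h2 : 0 <= (q / 2 - rho) * (Psi - r2) by rewrite mulr_ge0 ?subr_ge0.
have h3 : a ^+ 2 * G2 <= a ^+ 2 * (2 * Lf * dl) by rewrite ler_wpM2l ?sqr_ge0.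
have h4 : a * (dl + mu / 2 * r2) <= a * D by rewrite ler_wpM2l.
lra.
Qed.

(** The rate is the worse of [gamma * q * mu], for the distance to [xs], and
    [q / 2], for the dispersion; [kappa] is at least the inverse of the first and
    half the inverse of the second. *)
Lemma potential_contraction (R : realType) (d n tau : nat)
  (F : 'I_n -> 'rV[R]_d -> R) (mu Lf L : R) (xs : 'rV[R]_d)
  (phi : 'I_n -> 'rV[R]_d) :
  (1 < n)%N -> (0 < tau <= n)%N -> 0 < mu ->
  strongly_convex mu (average F) -> smooth_fun Lf (average F) ->
  (forall y, average F xs <= average F y) ->
  (forall i, convex_function [set: 'rV[R]_d] (F i)) ->
  (forall i, smooth_fun L (F i)) -> 0 <= L ->
  let N : R := n%:R in let t : R := tau%:R in
  let den := t * Lf + 6 * L * (N - t) / (N - 1) in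
  let gamma := N / den in
  let b := (N - t) / (N ^+ 2 * (N - 1)) in
  let kappa := Num.max (N / t)
    (Lf / mu + 6 * L / (t * mu) * ((N - t) / (N - 1))) in
  0 < den ->
  (\sum_(A : {set 'I_n}) nice_sampling R tau A *
    potential F gamma xs (4 * b) (miso_step F gamma A phi)
  <= (1 - (2 * kappa)^-1) * potential F gamma xs (4 * b) phi : Prop).
Proof.
move=> n1 /andP[tau0 taun] mu0 cf sf xs_min cF sF L0 N t den gamma b kappa den0.
have n0 : (0 < n)%N by apply: ltn_trans n1.
have t0 : 0 < t by rewrite ltr0n.
have tN : t <= N by rewrite ler_nat.
have N1 : 1 < N by rewrite (ltr_nat R 1).
have N0 : 0 < N by apply: lt_trans N1.
have N10 : 0 < N - 1 by rewrite subr_gt0.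
have b0 : 0 <= b.
  by rewrite divr_ge0 ?subr_ge0 // ltW // mulr_gt0 // exprn_gt0.
have opt := gradient_minimizer n0 sf xs_min sF.
have dF i y : differentiable (F i : 'rV[R]_d -> R^o) y by case: (sF i).
apply: le_trans (potential_step gamma phi n1 taun opt dF) _.
rewrite -/N -/t -/b; set x := miso_point F gamma phi; set q := t / N.
have := gradient_average_sqr_le sf xs_min x.
have := gradient_average_dotv_ge xs cf sf x.
have := sum_gradient_sqr_le n0 sf xs_min cF sF x.
have b40 : 0 <= 4 * b by rewrite mulr_ge0.
have := potential_ge gamma phi n0 opt b40; rewrite -/x -/N.
have := sqr_ge0 (enorm (x - xs)).
rewrite (_ : enorm (x - xs - _) ^+ 2 = enorm (x - xs) ^+ 2
  - 2 * (gamma * q) * dotv (x - xs) (gradient (average F) x)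
  + (gamma * q) ^+ 2 * enorm (gradient (average F) x) ^+ 2); last first.
  move: (x - xs) (gradient _ _) => e v; rewrite !enorm_sqr !dotvE (dotvC v e).
  move: (dotv e e) (dotv e v) (dotv v v) => a1 a2 a3; ring.
move: (potential _ _ _ _ _) (enorm (x - xs) ^+ 2) (dotv _ _)
  (average F x - average F xs) (enorm _ ^+ 2) (\sum_i _) => Psi r2 D dl G2 SG.
move=> r20 r2Psi SGle Dge G2le.
have qE : gamma * q = t / den by rewrite /gamma /q; field; rewrite !gt_eqF.
have a0 : 0 < gamma * q by rewrite qE divr_gt0.
have [kN kk] : N / t <= kappa /\ den / (t * mu) <= kappa.
  split; first by rewrite le_max lexx.
  rewrite (_ : den / (t * mu) = Lf / mu + 6 * L / (t * mu) * ((N - t) / (N - 1))).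
    by rewrite le_max lexx orbT.
  by rewrite /den; field; rewrite !gt_eqF.
have k0 : 0 < kappa by apply: lt_le_trans kN; rewrite divr_gt0.
have rate1 : (2 * kappa)^-1 <= q / 2.
  rewrite invfM mulrC ler_pM2r ?invr_gt0 // /q -[leRHS]invrK invf_div.
  by rewrite lef_pV2 // posrE divr_gt0.
have rate2 : (2 * kappa)^-1 <= gamma * q * mu.
  apply: (@le_trans _ _ kappa^-1).
    by rewrite lef_pV2 ?posrE ?mulr_gt0 // ler_peMl ?ler1n // ltW.
  rewrite qE mulrAC -[leRHS]invrK invf_div.
  by rewrite lef_pV2 // posrE divr_gt0 // mulr_gt0.
(* The choice of the stepsize: the component gradients cost what the gradient
   step of [f] leaves of [2 * (gamma * q)]. *)
have bE : 6 * b * q * gamma ^+ 2 * (2 * L * N)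
    = 2 * (gamma * q) - 2 * (gamma * q) ^+ 2 * Lf.
  rewrite qE /gamma /q /b.
  have -> : Lf = (den - 6 * L * (N - t) / (N - 1)) / t.
    by rewrite /den; field; rewrite !gt_eqF.
  by field; rewrite !gt_eqF.
have c0 : 0 <= 6 * b * q * gamma ^+ 2.
  have q0 : 0 <= q by rewrite divr_ge0 // ltW.
  by apply: mulr_ge0 (sqr_ge0 _); apply: mulr_ge0 q0; rewrite mulr_ge0.
have h1 : 6 * b * q * gamma ^+ 2 * SG
    <= (2 * (gamma * q) - 2 * (gamma * q) ^+ 2 * Lf) * dl.
  by rewrite -bE -[leRHS]mulrA ler_wpM2l.
by apply: (contraction_arith (mu := mu) (Lf := Lf) (dl := dl) (q := q)) => //;
  exact: ltW.
Qed.

Lemma geometric_decay_le (R : realType) (T eps Psi : R) (k : nat) :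
  1 <= T -> 0 < eps -> 0 <= Psi ->
  (T%:E * lne (Psi / eps)%:E <= k%:R%:E)%E ->
  (1 - T^-1) ^+ k * Psi <= eps.
Proof.
move=> T1 eps0 Psi0; have T0 : 0 < T by apply: lt_le_trans T1.
have [->|Psin0] := eqVneq Psi 0; first by rewrite mulr0 => _; exact: ltW.
have Psip : 0 < Psi by rewrite lt_neqAle eq_sym Psin0.
rewrite lne_EFin ?divr_gt0 // -EFinM lee_fin => kge.
rewrite -ler_pdivlMr //.
have c0 : 0 <= 1 - T^-1 by rewrite subr_ge0 invf_le1.
apply: (@le_trans _ _ (expR (- T^-1) ^+ k)).
  by rewrite lerXn2r ?nnegrE ?expR_ge0 // expR_ge1Dx.
rewrite -expRM_natl -[leRHS]lnK ?posrE ?divr_gt0 // ler_expR.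
rewrite -[eps / Psi]invf_div lnV ?posrE ?divr_gt0 // mulrN lerN2.
by rewrite ler_pdivlMr // mulrC.
Qed.

Theorem corollary5p4 (R : realType) (d n tau : nat)
  (F : 'I_n -> 'rV[R]_d -> R) (mu Lf L : R) (xstar : 'rV[R]_d)
  (phi0 : 'I_n -> 'rV[R]_d)
  (disp : measure_display) (T : measurableType disp) (P : probability T R)
  (S : nat -> T -> {set 'I_n})
  (hn : (4 <= n)%N)
  (htau : (1 <= tau <= n)%N)
  (hmu : 0 < mu)
  (hf_convex : strongly_convex mu (average F))
  (hf_smooth : smooth_fun Lf (average F))
  (hxstar : forall y, average F xstar <= average F y)
  (hF_convex : forall i, convex_function [set: 'rV[R]_d] (F i))
  (hF_smooth : forall i, smooth_fun L (F i))
  (hS : independent_draws P (@nice_sampling R n tau) S) :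
  let N : R := n%:R in
  let t : R := tau%:R in
  let gamma := N / (t * Lf + 6 * L * (N - t) / (N - 1)) in
  let A := N * (N - t) / (t * (N - 1)) in
  let W0 := \sum_(i < n)
    enorm (phi0 i - xstar - gamma *: gradient (F i) (phi0 i)
           + gamma *: gradient (F i) xstar) ^+ 2 in
  let x0 := miso_point F gamma phi0 in
  let x k w := miso_iterate F gamma phi0 (S^~ w) k in
  forall (eps : R) (k : nat), 0 < eps ->
    ((2 * Num.max (N / t)
            (Lf / mu + 6 * L / (t * mu) * ((N - t) / (N - 1))))%:E
     * lne ((enorm (x0 - xstar) ^+ 2 + 4 * A * t / N ^+ 3 * W0) / eps)%:E
     <= k%:R%:E)%E ->
    ('E_P[(fun w => enorm (x k w - xstar) ^+ 2)%R] <= eps%:E)%E.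
Proof.
move=> N t gamma A W0 x0 x eps k eps0.
have n1 : (1 < n)%N by apply: leq_trans hn.
have n0 : (0 < n)%N by apply: leq_trans hn.
have [tau0 taun] := andP htau.
have t0 : 0 < t by rewrite ltr0n.
have tN : t <= N by rewrite ler_nat.
have N1 : 1 < N by rewrite (ltr_nat R 1).
have N0 : 0 < N by apply: lt_trans N1.
have N10 : 0 < N - 1 by rewrite subr_gt0.
have L0 : 0 <= L by case: (hF_smooth (Ordinal n0)).
have Lf0 : 0 <= Lf by case: hf_smooth.
pose den := t * Lf + 6 * L * (N - t) / (N - 1).
have den2 : 0 <= 6 * L * (N - t) / (N - 1).
  by rewrite divr_ge0 ?(ltW N10) // !mulr_ge0 ?subr_ge0.
have opt := gradient_minimizer n0 hf_smooth hxstar hF_smooth.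
set kappa := Num.max _ _ => khyp.
have kN : N / t <= kappa by rewrite le_max lexx.
have Nt1 : 1 <= N / t by rewrite ler_pdivlMr // mul1r.
pose b := (N - t) / (N ^+ 2 * (N - 1)).
have b0 : 0 <= 4 * b.
  by rewrite mulr_ge0 // divr_ge0 ?subr_ge0 // ltW // mulr_gt0 // exprn_gt0.
have bE : 4 * A * t / N ^+ 3 = 4 * b.
  by rewrite /A /b; field; rewrite !gt_eqF.
(* Degenerate stepsize: [Lf = 0] makes the gradient of the average vanish, and
   strong convexity then leaves no point other than [xstar]. *)
have [den0|den0] := eqVneq den 0.
  have Lf00 : Lf = 0.
    apply/eqP; rewrite eq_le Lf0 andbT -(ler_pM2l t0) mulr0.
    by rewrite -den0 /den lerDl.
  have dist0 y : enorm (y - xstar) ^+ 2 = 0.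
    apply/eqP; rewrite eq_le sqr_ge0 andbT.
    have := gradient_average_sqr_le hf_smooth hxstar y.
    rewrite Lf00 mulr0 mul0r => G0.
    have {}G0 : enorm (gradient (average F) y) <= 0 * enorm (y - xstar).
      rewrite mul0r -(@ler_pXn2r _ 2) ?nnegrE ?enorm_ge0 //.
      by rewrite expr0n.
    have := dotv_le (lexx 0) G0; rewrite mul0r dotvC => D0.
    have D1 := gradient_average_dotv_ge xstar hf_convex hf_smooth y.
    rewrite -(ler_pM2l hmu) mulr0; have := le_trans D1 D0; have := hxstar y.
    move: (average F y) (average F xstar) (enorm _ ^+ 2) => u v r; lra.
  rewrite (_ : (fun w => _) = cst 0); last by apply/funext => w; exact: dist0.
  by rewrite expectation_cst lee_fin ltW.
have denp : 0 < den by rewrite lt_neqAle eq_sym den0 addr_ge0 // mulr_ge0 // ltW.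
have V0 phi : 0 <= potential F gamma xstar (4 * b) phi.
  exact: le_trans (sqr_ge0 _) (potential_ge gamma phi n0 opt b0).
have rate0 : 0 <= 1 - (2 * kappa)^-1.
  by rewrite subr_ge0 invf_le1; lra.
have contr phi := potential_contraction phi n1 htau hmu hf_convex hf_smooth
  hxstar hF_convex hF_smooth L0 denp.
have EV := run_contraction phi0 hS (@nice_ge0 R n tau) V0 rate0 contr k.
have U0 phi : 0 <= enorm (miso_point F gamma phi - xstar) ^+ 2 by exact: sqr_ge0.
have UV phi : enorm (miso_point F gamma phi - xstar) ^+ 2
    <= 1 * potential F gamma xstar (4 * b) phi.
  by rewrite mul1r; exact: potential_ge.
rewrite (_ : (fun w => enorm (x k w - xstar) ^+ 2) = (fun w => enorm
  (miso_point F gamma (run (miso_step F gamma) phi0 (S^~ w) k) - xstar) ^+ 2));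
  last by apply/funext => w; rewrite /x /miso_iterate miso_tableE.
apply: le_trans (run_expectation_le (miso_step F gamma) phi0 k hS U0 V0 ler01 UV) _.
rewrite mul1e; apply: le_trans EV _; rewrite lee_fin.
apply: (@le_trans _ _ ((1 - (2 * kappa)^-1) ^+ k *
  (enorm (x0 - xstar) ^+ 2 + 4 * b * W0))).
  by rewrite ler_wpM2l ?exprn_ge0 //; exact: potential_le.
rewrite bE in khyp; apply: geometric_decay_le => //; first lra.
by rewrite addr_ge0 ?sqr_ge0 // mulr_ge0 // sumr_ge0 // => i _; rewrite sqr_ge0.
Qed.
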